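(* Fix $\sigma^2>0$. Let $\mu$ be a probability law supported on $[a,b]$ with mean $\bar s=\mathbb E_\mu[S]$, where $0\le a<\bar s<b<\infty$. Define $$\mu_{\bar s}=\delta_{\bar s},\qquad \mu_{a,b,\bar s}=\frac{b-\bar s}{b-a}\delta_a+\frac{\bar s-a}{b-a}\delta_b .$$ Then for every $\omega>0$, $$L_{\mu_{\bar s}}(\omega)\le L_\mu(\omega)\le L_{\mu_{a,b,\bar s}}(\omega).$$ Hence, for every law $\pi$ on $\mathbb R$ with finite second moment, the same ordering holds for the greatest Bayes-VAMP fixed points and the associated lower bounds: $$\tau_B^+(\mu_{\bar s})\le\tau_B^+(\mu)\le\tau_B^+(\mu_{a,b,\bar s}),\qquad m_\pi(\tau_B^+(\mu_{\bar s}))\le m_\pi(\tau_B^+(\mu))\le m_\pi(\tau_B^+(\mu_{a,b,\bar s})).$$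
   Context: For a compactly supported probability law $\mu$ on $[0,\infty)$ with positive mean and $S\sim\mu$: for $\omega>0$, $L_\mu(\omega)=\mathbb E_\mu\big[\frac{\sigma^2\omega}{\sigma^2+\omega S}\big]\big/\mathbb E_\mu\big[\frac{\omega S}{\sigma^2+\omega S}\big]$, and $L_\mu(0)=\sigma^2/\mathbb E_\mu[S]$. With $B^\star\sim\pi$, $Z\sim N(0,1)$ independent, for $\tau>0$: $m_\pi(\tau)=\mathbb E[(\mathbb E[B^\star\mid B^\star+\sqrt\tau Z]-B^\star)^2]$, $\mathcal E_\pi(\tau)=\dfrac{m_\pi(\tau)}{1-m_\pi(\tau)/\tau}$, and $\tau_B^+(\mu)=\max\{\tau>0:L_\mu(\mathcal E_\pi(\tau))=\tau\}$. $\delta_x$ is the point mass at $x$. *)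

(* Defs.v *)
From HB Require Import structures.
From mathcomp Require Import all_boot all_order all_algebra interval_inference.
From mathcomp Require Import all_classical all_reals all_analysis.

Set Implicit Arguments.
Unset Strict Implicit.
Unset Printing Implicit Defensive.
Import Order.TTheory GRing.Theory Num.Theory.
Import numFieldNormedType.Exports.
Local Open Scope classical_set_scope.
Local Open Scope ring_scope.

Notation law R := (probability (measurableTypeR R) R).

Definition point_mass {R : realType} (x : R) : law R :=
  @dirac _ (measurableTypeR R) x R.

Section maximum.
Context {R : realType}.

Definition maxima (A : set R) : set R := A `&` ubound A.

(* The value 0 when A has no greatest element is arbitrary. *)
Definition setmax (A : set R) : R := xget 0 (maxima A).

End maximum.

Section conditional_expectation.
Context {d : measure_display} {T : measurableType d} {R : realType}.
Variable P : probability T R.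

Definition sigma_gen (Y : T -> R) : set (set T) :=
  preimage_set_system setT Y (@measurable _ (measurableTypeR R)).

Definition is_cond_exp (G : set (set T)) (X W : T -> R) : Prop :=
  [/\ forall V : set R, @measurable _ (measurableTypeR R) V -> G (W @^-1` V),
      P.-integrable setT (EFin \o W)
    & forall A, G A -> (\int[P]_(x in A) (W x)%:E = \int[P]_(x in A) (X x)%:E)%E].

(* Some version of E[X | Y]; versions exist for integrable X and measurable Y
   and agree P-almost surely. *)
Definition cond_exp (X Y : T -> R) : T -> R :=
  xget (fun=> 0) (is_cond_exp (sigma_gen Y) X).

Definition cond_mse (X Y : T -> R) : R :=
  fine 'E_P[fun w => (cond_exp X Y w - X w) ^+ 2].

End conditional_expectation.

Section two_point.
Context {R : realType} (a b s : R).
Hypotheses (has : a < s) (hsb : s < b).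

Let weight_a_ge0 : 0 <= (b - s) / (b - a).
Proof. by rewrite divr_ge0// subr_ge0 ltW// (lt_trans has). Qed.

Let weight_b_ge0 : 0 <= (s - a) / (b - a).
Proof. by rewrite divr_ge0// subr_ge0 ltW// (lt_trans has). Qed.

Definition two_point : set (measurableTypeR R) -> \bar R :=
  measure_add (mscale (NngNum weight_a_ge0) (point_mass a))
              (mscale (NngNum weight_b_ge0) (point_mass b)).

Let two_point0 : two_point set0 = 0%E.
Proof. exact: measure0. Qed.

Let two_point_ge0 A : (0 <= two_point A)%E.
Proof. exact: measure_ge0. Qed.

Let two_point_sigma_additive : semi_sigma_additive two_point.
Proof. exact: measure_semi_sigma_additive. Qed.

HB.instance Definition _ := isMeasure.Build _ _ _ two_point
  two_point0 two_point_ge0 two_point_sigma_additive.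

Let two_point_setT : two_point setT = 1%E.
Proof.
rewrite /two_point measure_addE.
rewrite -[LHS]/(((b - s) / (b - a))%:E * point_mass a setT
                + ((s - a) / (b - a))%:E * point_mass b setT)%E.
rewrite !probability_setT !mule1 -EFinD -mulrDl.
by rewrite addrA subrK divff// subr_eq0 gt_eqF// (lt_trans has).
Qed.

HB.instance Definition _ :=
  Measure_isProbability.Build _ _ R two_point two_point_setT.

End two_point.

Section bayes_vamp.
Context {R : realType}.

Definition Lmap (sigma2 : R) (mu : law R) (omega : R) : R :=
  if omega == 0 then sigma2 / fine 'E_mu[fun s => s]
  else fine 'E_mu[fun s => sigma2 * omega / (sigma2 + omega * s)] /
       fine 'E_mu[fun s => omega * s / (sigma2 + omega * s)].

(* The independent pair (B*, Z) is the pair of coordinates under the product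
   law of pi and N(0, 1). *)
Definition mmse (pi : law R) (tau : R) : R :=
  cond_mse (pi \x normal_prob 0%R 1%R)%E
    (fun w : measurableTypeR R * measurableTypeR R => w.1)
    (fun w => w.1 + Num.sqrt tau * w.2).

Definition extrinsic (pi : law R) (tau : R) : R :=
  mmse pi tau / (1 - mmse pi tau / tau).

Definition fixed_points (sigma2 : R) (pi mu : law R) : set R :=
  [set tau | 0 < tau /\ Lmap sigma2 mu (extrinsic pi tau) = tau].

Definition tauBplus (sigma2 : R) (pi mu : law R) : R :=
  setmax (fixed_points sigma2 pi mu).

End bayes_vamp.

(* Main.v *)
(* Put B(w) = E[S / (sigma2 + w S)]; then L_mu(w) = 1 / B(w) - w.  As
   s |-> s / (sigma2 + w s) is concave on [a, b], Jensen's inequality and the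
   chord inequality bound B, and Jensen for t |-> t / (1 + d t) shows that L_mu
   is nondecreasing.  The extrinsic error E_pi is nondecreasing too: given the
   observation of B* with noise variance t2, an independent observation whose
   noise variance k satisfies 1 / k = 1 / t1 - 1 / t2 carries the same
   information as noise variance t1, and combining it linearly with the
   posterior mean gives 1 / m(t1) >= 1 / m(t2) + 1 / k.  So
   h = L_mu \o E_pi is nondecreasing, and sup {t | t <= h t} is its greatest
   fixed point by Tarski's argument; continuity of the mmse is never needed.
   This supremum is monotone in h, hence ordered like L. *)
Require Import Defs.
From HB Require Import structures.
From mathcomp Require Import all_boot all_order all_algebra.
From mathcomp Require Import all_classical all_reals all_analysis.
From mathcomp Require Import finmap measurable_realfun ring lra.
Import Order.TTheory GRing.Theory Num.Def Num.Theory.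
Import numFieldNormedType.Exports.
Local Open Scope classical_set_scope.
Local Open Scope ring_scope.

(** * Gaussian integrals *)

Section affine.
Context {R : realType}.
Local Notation leb := (@lebesgue_measure R).

Definition affine (m s : R) : measurableTypeR R -> measurableTypeR R :=
  fun x => m + s * x.

Lemma measurable_affine m s : measurable_fun setT (affine m s).
Proof. by apply: measurable_funD => //; exact: measurable_funM. Qed.

HB.instance Definition _ m s := isMeasurableFun.Build _ _ _ _ (affine m s)
  (measurable_affine m s).

(** Lebesgue measure equals [|s|] times its image under [affine m s]: the two agree on half-open
    intervals, which determines them. The sign of [s] is free, so that reflections are covered. *)
Lemma ge0_integral_affine (m s : R) (f : R -> \bar R) : s != 0 ->
  measurable_fun setT f -> (forall x, 0 <= f x)%E ->
  (\int[leb]_x f x = \int[leb]_x (`|s|%:E * f (affine m s x)))%E.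
Proof.
move=> s0 mf f0.
have E A : measurable A ->
    leb A = mscale (NngNum (normr_ge0 s)) (pushforward leb (affine m s)) A.
  move=> mA; apply: lebesgue_measure_unique => //= _ [[u v] /= uv <-].
  suff : (leb `]u, v] = `|s|%:E * leb (affine m s @^-1` `]u, v]))%E by [].
  move: s0; rewrite neq_lt => /orP[s0|s0].
    have -> : affine m s @^-1` `]u, v] = `[(v - m) / s, (u - m) / s[%classic.
      apply/seteqP; split => x; rewrite /affine /= !in_itv/=.
        by rewrite ler_ndivrMr// ltr_ndivlMr// => /andP[? ?]; apply/andP; split; lra.
      by rewrite ler_ndivrMr// ltr_ndivlMr// => /andP[? ?]; apply/andP; split; lra.
    rewrite !lebesgue_measure_itv/= !lte_fin ltr_ndivlMr// divfK ?lt_eqF//.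
    rewrite ltrD2r; case: ifPn => _; rewrite ?mule0// -!EFinB -EFinM ltr0_norm//.
    by congr EFin; field; rewrite lt_eqF.
  have -> : affine m s @^-1` `]u, v] = `](u - m) / s, (v - m) / s]%classic.
    apply/seteqP; split => x; rewrite /affine /= !in_itv/=.
      by rewrite ler_pdivlMr// ltr_pdivrMr// => /andP[? ?]; apply/andP; split; lra.
    by rewrite ler_pdivlMr// ltr_pdivrMr// => /andP[? ?]; apply/andP; split; lra.
  rewrite !lebesgue_measure_itv/= !lte_fin ltr_pdivrMr// divfK ?gt_eqF//.
  rewrite ltrD2r; case: ifPn => _; rewrite ?mule0// -!EFinB -EFinM gtr0_norm//.
  by congr EFin; field; rewrite gt_eqF.
rewrite (eq_measure_integral
  (mscale (NngNum (normr_ge0 s)) (pushforward leb (affine m s))))/=; last first.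
  by move=> A mA _; exact: E.
rewrite ge0_integral_mscale// ge0_integral_pushforward//.
rewrite preimage_setT -ge0_integralZl//.
  exact: measurableT_comp.
by move=> x _; exact: f0.
Qed.

Definition gauss : law R := normal_prob 0 1.

Local Notation phi := (normal_pdf (0 : R) 1).

(** The Radon-Nikodym derivative of [gauss] and the explicit density have equal integrals over every
    measurable set, hence agree almost everywhere. *)
Lemma ge0_integral_gauss (f : R -> \bar R) :
  measurable_fun setT f -> (forall x, 0 <= f x)%E ->
  (\int[gauss]_x f x = \int[leb]_x (f x * (phi x)%:E))%E.
Proof.
move=> mf f0.
have dom : gauss `<< leb by exact: normal_prob_dominates.
rewrite -(Radon_Nikodym_SigmaFinite.change_of_variables dom)//.
apply: ae_eq_integral => //.
- apply: emeasurable_funM => //.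
  exact: measurable_int (Radon_Nikodym_SigmaFinite.f_integrable dom).
- by apply: emeasurable_funM => //; apply/measurable_EFinP; exact: measurable_normal_pdf.
apply: ae_eqe_mul2l; apply: integral_ae_eq => //.
- exact: Radon_Nikodym_SigmaFinite.f_integrable.
- by apply/measurable_EFinP; exact: measurable_normal_pdf.
by move=> A _ mA; rewrite -Radon_Nikodym_SigmaFinite.f_integral.
Qed.

Lemma normal_pdf_affine (m s x : R) : s != 0 ->
  `|s| * normal_pdf m s (affine m s x) = phi x.
Proof.
move=> s0; rewrite !normal_pdfE ?oner_eq0// /normal_peak /normal_fun /affine.
rewrite expr1n mul1r -[in LHS]mulrnAr sqrtrM ?sqr_ge0// sqrtr_sqr invfM mulrA mulrA.
rewrite mulfV ?normr_eq0// mul1r; congr (_ * expR _).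
by field.
Qed.

(* Both sides are the joint density at [(u, v)] of two standard normal
   variables with correlation [a]. *)
Lemma normal_pdf_rotate (a b u v : R) : b != 0 -> a ^+ 2 + b ^+ 2 = 1 ->
  phi u * normal_pdf (a * u) b v = phi v * normal_pdf (a * v) b u.
Proof.
move=> b0 ab; rewrite !normal_pdfE ?oner_eq0// /normal_fun.
rewrite mulrACA [in RHS]mulrACA -!expRD; congr (_ * expR _).
(* The exponents differ by a multiple of [1 - (a ^+ 2 + b ^+ 2)]; inserting that multiple leaves an
   identity free of the constraint. *)
rewrite -[RHS]addr0 -[X in _ = _ + X](_ :
  (u ^+ 2 - v ^+ 2) * (1 - (a ^+ 2 + b ^+ 2)) / (b ^+ 2 *+ 2) = 0).
  by field.
by rewrite ab subrr mulr0 mul0r.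
Qed.

(* Since [1 + k x^2 / 2 <= exp (k x^2 / 2)] for [k = 1 - s^-2], comparing with
   the total mass of N(0, s^2) gives [1 + k v / 2 <= s] for the second moment
   [v], that is [v <= 2 s^2 / (s + 1)]; then let [s] tend to 1. *)
Lemma gauss_sqr_le1 : (\int[gauss]_x (x ^+ 2)%:E <= 1)%E.
Proof.
have mx2 : measurable_fun setT (fun x : R => (x ^+ 2)%:E).
  by apply/measurable_EFinP; exact: measurable_funX.
set v := (\int[gauss]_x _)%E.
have v0 : (0 <= v)%E by apply: integral_ge0 => x _; rewrite lee_fin sqr_ge0.
have key (s : R) : 1 < s -> (1 + ((1 - s ^- 2) / 2)%:E * v <= s%:E)%E.
  move=> s1; have s0 : s != 0 by rewrite gt_eqF// (lt_trans _ s1).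
  have k0 : 0 <= (1 - s ^- 2) / 2.
    by rewrite divr_ge0// subr_ge0 invf_le1 ?exprn_gt0 ?(lt_trans _ s1)// exprn_ege1// ltW.
  have -> : s%:E = (\int[leb]_x (s * normal_pdf 0 s x)%:E)%E.
    under eq_integral do rewrite EFinM.
    rewrite ge0_integralZl//.
    - by rewrite integral_normal_pdf mule1.
    - by apply/measurable_EFinP; exact: measurable_normal_pdf.
    - by move=> x _; rewrite lee_fin normal_pdf_ge0.
    - by rewrite lee_fin (le_trans _ (ltW s1)).
  have <- : (\int[gauss]_x (1 + ((1 - s ^- 2) / 2) * x ^+ 2)%:E =
      1 + ((1 - s ^- 2) / 2)%:E * v)%E.
    under eq_integral do rewrite EFinD EFinM.
    rewrite ge0_integralD//.
    - rewrite integral_cst// mul1e ge0_integralZl//.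
        by rewrite -[X in (X + _)%E]/(gauss setT) probability_setT.
      by move=> x _; rewrite lee_fin sqr_ge0.
    - by move=> x _; rewrite -EFinM lee_fin mulr_ge0// sqr_ge0.
    - exact: measurable_funeM.
  rewrite ge0_integral_gauss; last 2 first.
    by apply/measurable_EFinP; apply: measurable_funD => //; exact: measurable_funM.
    by move=> x; rewrite lee_fin addr_ge0// mulr_ge0// sqr_ge0.
  apply: ge0_le_integral => //.
  - move=> x _; rewrite -EFinM lee_fin mulr_ge0 ?normal_pdf_ge0//.
    by rewrite addr_ge0// mulr_ge0// sqr_ge0.
  - under eq_fun do rewrite -EFinM.
    apply/measurable_EFinP; apply: measurable_funM; last exact: measurable_normal_pdf.
    by apply: measurable_funD => //; exact: measurable_funM.
  - apply/measurable_EFinP; apply: measurable_funM => //; exact: measurable_normal_pdf.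
  - move=> x _; rewrite -EFinM lee_fin.
    have -> : s * normal_pdf 0 s x = expR (((1 - s ^- 2) / 2) * x ^+ 2) * phi x.
      rewrite !normal_pdfE ?oner_eq0// /normal_peak /normal_fun.
      rewrite expr1n mul1r -mulrnAr sqrtrM ?sqr_ge0// sqrtr_sqr gtr0_norm ?(lt_trans _ s1)//.
      rewrite invfM mulrA mulrA mulfV// mul1r mulrCA -expRD; congr (_ * expR _).
      by field.
    by rewrite ler_wpM2r ?normal_pdf_ge0// expR_ge1Dx.
have vfin : v \is a fin_num.
  rewrite ge0_fin_numE// ltNge leye_eq; apply/negP => /eqP vy.
  have := key 2 (ltr1n _ 2); rewrite vy gt0_muley ?lte_fin; last by lra.
  by rewrite addey.
rewrite -(fineK vfin) lee_fin; apply/ler_addgt0Pr => e e0.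
have r0 : 0 <= fine v by rewrite fine_ge0.
(* Divided by [t], the bound [key] at [1 + t] reads [(2 + t) v <= 2 (1 + t)^2]; for [t <= 1] this
   gives [v <= 1 + 3 t], hence [v <= 1 + e]. *)
pose t := minr 1 (e / 3).
have t0 : 0 < t by rewrite lt_min ltr01 divr_gt0.
have t1 : t <= 1 by rewrite ge_min lexx.
have te : t <= e / 3 by rewrite ge_min lexx orbT.
have := key (1 + t); rewrite -(fineK vfin) -EFinM -EFinD lee_fin ltrDl => /(_ t0).
have -> : (1 - (1 + t) ^- 2) / 2 * fine v = t * ((2 + t) * fine v) / (2 * (1 + t) ^+ 2).
  by field; rewrite gt_eqF// addr_gt0.
rewrite lerD2l ler_pdivrMr ?mulr_gt0 ?exprn_gt0 ?addr_gt0// ler_pM2l//.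
by nra.
Qed.

(** Used for estimation errors: [p] is the part fixed by the conditioning and [q] the coefficient of
    an independent Gaussian noise. *)
Lemma gauss_affine_sqr_le (p q : R) :
  (\int[gauss]_x ((p + q * x) ^+ 2)%:E <= (p ^+ 2 + q ^+ 2)%:E)%E.
Proof.
have mx2 : measurable_fun setT (fun x : R => (x ^+ 2)%:E).
  by apply/measurable_EFinP; exact: measurable_funX.
have m2 r : measurable_fun setT (fun x : R => ((p + r * x) ^+ 2)%:E).
  by apply/measurable_EFinP; apply: measurable_funX; apply: measurable_funD.
have p0 r x : (0 <= ((p + r * x) ^+ 2)%:E)%E by rewrite lee_fin sqr_ge0.
pose I r := (\int[gauss]_x ((p + r * x) ^+ 2)%:E)%E.
(* Averaging over [x] and [- x] cancels the cross term. *)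
have sym : I (- q) = I q.
  rewrite /I ge0_integral_gauss// [RHS]ge0_integral_gauss//.
  rewrite [RHS](@ge0_integral_affine 0 (- 1)) ?oppr_eq0 ?oner_eq0//; last 2 first.
  - by apply: emeasurable_funM => //; apply/measurable_EFinP; exact: measurable_normal_pdf.
  - by move=> x; rewrite mule_ge0// lee_fin normal_pdf_ge0.
  apply: eq_integral => x _; rewrite normrN1 mul1e /affine add0r mulN1r.
  congr ((_ ^+ 2)%:E * _%:E)%E; first by ring.
  by rewrite !normal_pdfE ?oner_eq0// /normal_fun !subr0 sqrrN.
have : (I q + I (- q)%R <= (2 * (p ^+ 2 + q ^+ 2))%:E)%E.
  rewrite -ge0_integralD//; [|exact: m2|exact: m2].
  under eq_integral => x _.
    rewrite -EFinD (_ : _ + _ = 2 * p ^+ 2 + 2 * q ^+ 2 * x ^+ 2); last by ring.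
    rewrite EFinD [X in (_ + X)%E]EFinM; over.
  rewrite ge0_integralD//; last 3 first.
  - by move=> x _; rewrite lee_fin; have := sqr_ge0 p; lra.
  - by move=> x _; rewrite -EFinM lee_fin -mulrA mulr_ge0// mulr_ge0 ?sqr_ge0.
  - exact: measurable_funeM.
  rewrite integral_cst// ge0_integralZl//; last 2 first.
  - by move=> x _; rewrite lee_fin sqr_ge0.
  - by rewrite lee_fin; have := sqr_ge0 q; lra.
  rewrite -[X in (_ * X + _)%E]/(gauss setT) probability_setT mule1 mulrDr EFinD.
  rewrite leeD2l// -[leRHS]mule1 lee_wpmul2l ?gauss_sqr_le1//.
  by rewrite lee_fin; have := sqr_ge0 q; lra.
rewrite sym -/(I q); have : (0 <= I q)%E by exact: integral_ge0.
by case: (I q) => [r| |]//; rewrite -EFinD !lee_fin; lra.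
Qed.

End affine.

Section rotation.
Context {R : realType}.
Local Notation leb := (@lebesgue_measure R).
Local Notation phi := (normal_pdf (0 : R) 1).

(* The rotation is done one coordinate at a time: [u = a z + b w] for fixed
   [z], then [z = a u + b v] for fixed [u]. *)
Lemma ge0_integral_gauss_rotate (a b : R)
    (F : measurableTypeR R * measurableTypeR R -> \bar R) :
  b != 0 -> a ^+ 2 + b ^+ 2 = 1 ->
  measurable_fun setT F -> (forall x, 0 <= F x)%E ->
  (\int[gauss]_z \int[gauss]_w F (a * z + b * w, b * z - a * w)%R =
   \int[gauss]_u \int[gauss]_v F (u, v))%E.
Proof.
move=> b0 ab mF F0.
(* Here [p] is [(z, u)]. As [w = (u - a z) / b], the coordinate [b z - a w] becomes [(z - a u) / b],
   and the density is that of [u] given [z]. *)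
pose H (p : measurableTypeR R * measurableTypeR R) : \bar R :=
  (F (p.2, (p.1 - a * p.2) / b)%R * (normal_pdf (a * p.1) b p.2)%:E)%E.
have H0 p : (0 <= H p)%E by rewrite mule_ge0// lee_fin normal_pdf_ge0.
have mH : measurable_fun setT H.
  apply: emeasurable_funM.
    apply: (measurableT_comp mF); apply: measurable_fun_pair => //.
    apply: measurable_funM => //; apply: measurable_funB => //.
    exact: measurable_funM.
  apply/measurable_EFinP; rewrite (_ : (fun p => _) =
    (fun p : measurableTypeR R * measurableTypeR R => normal_pdf 0 b (p.2 - a * p.1))).
    apply: (measurableT_comp (measurable_normal_pdf 0 b)).
    by apply: measurable_funB => //; exact: measurable_funM.
  by apply/funext => p; rewrite !normal_pdfE// /normal_fun subr0.
have mFz z : measurable_fun setT (fun w : measurableTypeR R =>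
    F (a * z + b * w, b * z - a * w)%R).
  apply: (measurableT_comp mF); apply: measurable_fun_pair => //.
    by apply: measurable_funD => //; exact: measurable_funM.
  by apply: measurable_funB => //; exact: measurable_funM.
have mFu u : measurable_fun setT (fun v : measurableTypeR R => F (u, v)).
  by apply: (measurableT_comp mF); exact: measurable_fun_pair.
transitivity (\int[gauss]_z \int[leb]_u H (z, u))%E.
  apply: eq_integral => z _.
  have mHz : measurable_fun setT (fun u : measurableTypeR R => H (z, u)).
    by apply: (measurableT_comp mH); exact: measurable_fun_pair.
  have -> := @ge0_integral_affine R (a * z) b (fun u => H (z, u)) b0 mHz (fun u => H0 _).
  have -> := @ge0_integral_gauss R _ (mFz z) (fun w => F0 _).
  apply: eq_integral => w _; rewrite /H /=.
  rewrite muleCA -EFinM normal_pdf_affine//; congr (F (_, _) * _)%E.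
  rewrite /affine; apply: (mulIf b0); rewrite divfK//.
  have -> : (b * z - a * w) * b = z * (a ^+ 2 + b ^+ 2) - a * (a * z + b * w).
    by ring.
  by rewrite ab mulr1.
rewrite (@fubini_tonelli _ _ _ _ _ gauss leb)//.
have mK : measurable_fun setT (fun u => \int[@gauss R]_v F (u, v))%E.
  exact: (@measurable_fun_fubini_tonelli_F _ _ _ _ _ gauss F).
rewrite [RHS]ge0_integral_gauss//; last by move=> u; exact: integral_ge0.
apply: eq_integral => u _.
have mHu : measurable_fun setT (fun z : measurableTypeR R => H (z, u)).
  by apply: (measurableT_comp mH); exact: measurable_fun_pair.
have mHp : measurable_fun setT (fun z : measurableTypeR R => H (z, u) * (phi z)%:E)%E.
  by apply: emeasurable_funM => //; apply/measurable_EFinP; exact: measurable_normal_pdf.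
have Hp0 z : (0 <= H (z, u) * (phi z)%:E)%E.
  by rewrite mule_ge0// lee_fin normal_pdf_ge0.
have -> := @ge0_integral_gauss R _ mHu (fun z => H0 _).
have -> := @ge0_integral_affine R (a * u) b _ b0 mHp Hp0.
have -> := @ge0_integral_gauss R _ (mFu u) (fun v => F0 _).
rewrite -ge0_integralZr//.
- apply: eq_integral => v _; rewrite /H /= -muleA -[in RHS]muleA -!EFinM muleCA -EFinM.
  rewrite [X in (_ * X%:E)%E](_ : _ = phi v * phi u); last first.
    by rewrite [X in _ * X]mulrC normal_pdf_rotate// mulrCA normal_pdf_affine// mulrC.
  congr (F (_, _) * _)%E; rewrite /affine; field; exact: b0.
- by apply: emeasurable_funM => //; apply/measurable_EFinP; exact: measurable_normal_pdf.
- by move=> v _; rewrite mule_ge0// lee_fin normal_pdf_ge0.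
- by rewrite lee_fin normal_pdf_ge0.
Qed.

End rotation.

(** * Conditional expectation as least-squares projection *)

Section orthogonality.
Context {d d' : measure_display} {T : measurableType d} {T' : measurableType d'}
  {R : realType} (P : probability T R) (y : T -> T')
  (my : measurable_fun setT y).

Let mpre {A} : measurable A -> measurable (y @^-1` A).
Proof. by move=> mA; rewrite -[X in measurable X]setTI; exact: my. Qed.

Import HBNNSimple.

(** The level sets of a simple function of [y] contribute 0 each; simple approximations of [f] from
    below and dominated convergence, with bound [M |D|], give the rest. *)
Lemma integral_bounded_mul_eq0 (D : T -> R) (f : T' -> R) (M : R) :
  P.-integrable setT (EFin \o D) ->
  (forall A, measurable A -> \int[P]_(t in y @^-1` A) (D t)%:E = 0)%E ->
  measurable_fun setT f -> (forall u, 0 <= f u <= M) ->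
  (\int[P]_t (f (y t) * D t)%:E = 0)%E.
Proof.
move=> iD D0 mf f0M.
have mD : measurable_fun setT D by apply/measurable_EFinP/(measurable_int P).
have mEf : measurable_fun setT (EFin \o f) by apply/measurable_EFinP.
have f0 u : (0 <= (EFin \o f) u)%E by rewrite lee_fin; have /andP[] := f0M u.
pose g := nnsfun_approx measurableT mEf.
have cg u : (g n u @[n --> \oo]) --> f u.
  rewrite /g; under eq_fun do rewrite nnsfun_approxE.
  exact: (@cvg_approx _ _ _ setT (EFin \o f) _ (fun x _ => f0 x) I (ltry _)).
have gM n u : `|g n u| <= M.
  rewrite ger0_norm//; have /andP[_] := f0M u; apply: le_trans.
  rewrite -lee_fin /g nnsfun_approxE.
  exact: (@le_approx _ _ _ setT (EFin \o f)).
have int0 n : (\int[P]_t (g n (y t) * D t)%:E = 0)%E.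
  have mE r : measurable (y @^-1` (g n @^-1` [set r])).
    by apply/mpre/measurable_sfunP.
  have E t : ((g n (y t) * D t)%:E = \sum_(r <- fset_set (range (g n)))
      (r%:E * ((EFin \o D) \_ (y @^-1` (g n @^-1` [set r]))) t))%E.
    rewrite [in LHS](fimfunE (g n)) fsbig_finite//= mulr_suml -sumEFin.
    apply: eq_bigr => r _; rewrite patchE indicE /=.
    have -> : (t \in y @^-1` (g n @^-1` [set r])) = (y t \in g n @^-1` [set r]).
      by apply/idP/idP => /set_mem H; apply/mem_set.
    by case: ifPn => _; [rewrite mulr1 EFinM|rewrite mulr0 mul0r mule0].
  have iDA r : P.-integrable setT ((EFin \o D) \_ (y @^-1` (g n @^-1` [set r]))).
    by apply/(integrable_mkcond _ (mE r)); exact: integrableS iD.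
  under eq_integral do rewrite E.
  rewrite integral_sum//=; last by move=> r; exact: integrableZl.
  rewrite big1// => r _; rewrite integralZl//.
  by rewrite -integral_mkcond D0 ?mule0//; exact: measurable_sfunP.
have [] := @dominated_convergence _ _ _ P setT measurableT
  (fun n t => (g n (y t) * D t)%:E) (fun t => (f (y t) * D t)%:E)
  (fun t => (M%:E * `|(D t)%:E|)%E).
- move=> n; apply/measurable_EFinP; apply: measurable_funM => //.
  exact: measurableT_comp.
- by apply/measurable_EFinP; apply: measurable_funM => //; exact: measurableT_comp.
- apply: aeW => t _; apply: cvg_EFin; first exact: nearW.
  by apply: cvgMr_tmp; exact: cg.
- by apply: integrableZl => //; exact: integrable_abse.
- apply: aeW => t n _; rewrite -EFinM lee_fin normrM.
  by apply: ler_wpM2r.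
move=> _ _; rewrite /=; under eq_fun do rewrite int0.
by move/cvg_lim => <-//; rewrite lim_cst.
Qed.

End orthogonality.

Section optimality.
Context {d d' : measure_display} {T : measurableType d} {T' : measurableType d'}
  {R : realType} (P : probability T R) (y : T -> T')
  (my : measurable_fun setT y).

(** Pythagoras: [W - X] is orthogonal to functions of [y]. The codomain of [y] is arbitrary so that
    [y] may be the identity into [T] with a coarser sigma-algebra. *)
Lemma le_integral_cond_exp_sqr (X : T -> R) (W H : T' -> R) :
  P.-integrable setT (EFin \o X) -> P.-integrable setT (EFin \o (W \o y)) ->
  measurable_fun setT W -> measurable_fun setT H ->
  (forall A, measurable A ->
    \int[P]_(t in y @^-1` A) (W (y t))%:E = \int[P]_(t in y @^-1` A) (X t)%:E)%E ->
  (\int[P]_t ((W (y t) - X t) ^+ 2)%:E <= \int[P]_t ((H (y t) - X t) ^+ 2)%:E)%E.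
Proof.
move=> iX iW mW mH WX.
have mpre A : measurable A -> measurable (y @^-1` A).
  by move=> mA; rewrite -[X in measurable X]setTI; exact: my.
have mX : measurable_fun setT X by apply/measurable_EFinP/(measurable_int P).
have mWy : measurable_fun setT (W \o y) by exact: measurableT_comp.
have mHy : measurable_fun setT (H \o y) by exact: measurableT_comp.
pose D t := W (y t) - X t.
have iD : P.-integrable setT (EFin \o D).
  exact: (integrableB measurableT iW iX).
have mD : measurable_fun setT D by exact: measurable_funB.
have D0 A : measurable A -> (\int[P]_(t in y @^-1` A) (D t)%:E = 0)%E.
  move=> mA; under eq_integral do rewrite EFinB.
  have iXA : P.-integrable (y @^-1` A) (EFin \o X).
    by apply: integrableS iX => //; exact: mpre.
  rewrite integralB//; [|exact: mpre|by apply: integrableS iW => //; exact: mpre].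
  by rewrite WX// subee// integrable_fin_num//; exact: mpre.
(* On [A n] both estimators are bounded by [n], so orthogonality applies to the
   cross term; no square-integrability of [W] has to be known beforehand. *)
pose A n := [set u | `|W u| <= n%:R /\ `|H u| <= n%:R].
have mA n : measurable (A n).
  apply: measurableI.
    have := @measurableT_comp _ _ _ _ _ _ (@normr R R) _ W (@normr_measurable R setT) mW.
    move=> /(_ measurableT `]-oo, n%:R]%classic (measurable_itv _)).
    by rewrite setTI; congr measurable; apply/seteqP; split => u /=; rewrite in_itv.
  have := @measurableT_comp _ _ _ _ _ _ (@normr R R) _ H (@normr_measurable R setT) mH.
  move=> /(_ measurableT `]-oo, n%:R]%classic (measurable_itv _)).
  by rewrite setTI; congr measurable; apply/seteqP; split => u /=; rewrite in_itv.
have mD2 : measurable_fun setT (fun t => ((W (y t) - X t) ^+ 2)%:E).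
  by apply/measurable_EFinP; exact: measurable_funX.
have mHX2 : measurable_fun setT (fun t => ((H (y t) - X t) ^+ 2)%:E).
  by apply/measurable_EFinP; apply: measurable_funX; exact: measurable_funB.
suff h n : (\int[P]_(t in y @^-1` A n) ((W (y t) - X t) ^+ 2)%:E <=
            \int[P]_t ((H (y t) - X t) ^+ 2)%:E)%E.
  have nd : nondecreasing_seq (fun n => y @^-1` A n).
    move=> m n mn; apply/subsetPset => t [] /= h1 h2.
    by split; [apply: le_trans h1 _|apply: le_trans h2 _]; rewrite ler_nat.
  have cv := @ge0_nondecreasing_set_cvg_integral _ _ _ (fun n => y @^-1` A n)
    (fun t => ((W (y t) - X t) ^+ 2)%:E) P nd.
  have UT : \bigcup_n (y @^-1` A n) = setT.
    apply/seteqP; split => // t _.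
    exists (truncn (maxr `|W (y t)| `|H (y t)|)).+1 => //.
    have := ltW (truncnS_gt (maxr `|W (y t)| `|H (y t)|)).
    by rewrite ge_max => /andP[].
  rewrite UT in cv; apply: (cvge_to_le (cv _ _ _)).
  - by move=> n; exact/mpre/mA.
  - by move=> n; exact: measurable_funTS.
  - by move=> n t _; rewrite lee_fin sqr_ge0.
  - exact: nearW.
have [hoo|] := eqVneq (\int[P]_t ((H (y t) - X t) ^+ 2)%:E)%E +oo%E.
  by rewrite hoo leey.
rewrite -ltey => Hlty.
have iH2 : P.-integrable setT (fun t => ((H (y t) - X t) ^+ 2)%:E).
  apply/integrableP; split => //.
  by under eq_integral do rewrite gee0_abs ?lee_fin ?sqr_ge0//.
pose k u := (H u - W u) * \1_(A n) u.
have mk : measurable_fun setT k.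
  by apply: measurable_funM; [exact: measurable_funB|exact: measurable_indic].
have kb u : `|k u| <= 2 * n%:R.
  rewrite /k indicE; case: (boolP (u \in A n)) => [/set_mem[Wu Hu]|_].
    by rewrite mulr1 (le_trans (ler_normB _ _))// mulr2n mulrDl !mul1r lerD.
  by rewrite mulr0 normr0 mulr_ge0.
(* The weight [k] is signed, whereas [integral_bounded_mul_eq0] asks for a nonnegative one; [k] is
   therefore shifted by its bound [2 n], and the constant part integrates to 0 as well. *)
have iM : P.-integrable setT (fun t => ((2 * n%:R) * D t)%:E).
  exact: (integrableZl measurableT (2 * n%:R) iD).
have ikM : P.-integrable setT (fun t => ((k (y t) + 2 * n%:R) * D t)%:E).
  apply: (@integrableMr _ _ _ _ _ measurableT
    (fun t => k (y t) + 2 * n%:R) (EFin \o D)) => //.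
    by apply: measurable_funD => //; exact: measurableT_comp.
  exists (4 * n%:R); split=> // M ltM t _ /=; apply: le_trans (ltW ltM).
  rewrite (le_trans (ler_normD _ _))// (ger0_norm (_ : 0 <= 2 * n%:R)) ?mulr_ge0//.
  by have := kb (y t); lra.
have ik : P.-integrable setT (fun t => (k (y t) * D t)%:E).
  have := integrableB measurableT ikM iM; apply: eq_integrable => // t _ /=.
  by rewrite -EFinB; congr EFin; ring.
have k0 : (\int[P]_t (k (y t) * D t)%:E = 0)%E.
  have f0 : (\int[P]_t ((k (y t) + 2 * n%:R) * D t)%:E = 0)%E.
    apply: (@integral_bounded_mul_eq0 _ _ _ _ _ P y my D
      (fun u => k u + 2 * n%:R) (4 * n%:R) iD D0).
      exact: measurable_funD.
    by move=> u; have := kb u; rewrite ler_norml; lra.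
  have g0 : (\int[P]_t ((2 * n%:R) * D t)%:E = 0)%E.
    under eq_integral do rewrite EFinM.
    by rewrite integralZl// -(preimage_setT y) D0// mule0.
  have := integralB measurableT ikM iM; rewrite f0 g0 sube0 => <-.
  by apply: eq_integral => t _; rewrite -EFinB; congr EFin; ring.
rewrite integral_mkcond.
apply: (@le_trans _ _
  (\int[P]_t (((H (y t) - X t) ^+ 2)%:E - (2%:E * (k (y t) * D t)%:E)))%E);
  last first.
  by rewrite integralB//; [rewrite integralZl// k0 mule0 sube0|exact: integrableZl].
(* On [A n] the two sides differ by [(H - W) ^+ 2]; off [A n] both [k] and the left side vanish. *)
have pw t : (((fun t => ((W (y t) - X t) ^+ 2)%:E) \_ (y @^-1` A n)) t <=
   (((H (y t) - X t) ^+ 2)%:E - (2%:E * (k (y t) * D t)%:E)))%E.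
  rewrite patchE /k indicE.
  have -> : (t \in y @^-1` A n) = (y t \in A n).
    by apply/idP/idP => /set_mem ?; apply/mem_set.
  case: ifPn => _; rewrite -EFinM -EFinB lee_fin /D; last first.
    by rewrite !(mulr0, mul0r) subr0 sqr_ge0.
  by rewrite mulr1; have := sqr_ge0 (H (y t) - W (y t)); lra.
apply: ge0_le_integral => //.
- by move=> t _; rewrite patchE; case: ifPn => _ //; rewrite lee_fin sqr_ge0.
- by apply/(measurable_restrictT _ (mpre _ (mA n))); exact: measurable_funTS.
- apply: emeasurable_funB => //.
  by apply: measurable_funeM; exact: (measurable_int P ik).
Qed.

End optimality.

Section conditional_mse.
Context {d : measure_display} {T : measurableType d} {R : realType}
  (P : probability T R) (X Y : T -> R).
Hypotheses (iX : P.-integrable setT (EFin \o X)) (mY : measurable_fun setT Y).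

(** The regression function [w] is the Radon-Nikodym derivative, with respect to the law of [Y], of
    the image under [Y] of the charge with density [X]. *)
Lemma cond_exp_factor : exists w : R -> R,
  [/\ measurable_fun setT w, P.-integrable setT (EFin \o (w \o Y)) &
      forall A : set R, measurable A ->
        (\int[P]_(t in Y @^-1` A) (w (Y t))%:E = \int[P]_(t in Y @^-1` A) (X t)%:E)%E].
Proof.
pose Ym : {mfun T >-> measurableTypeR R} :=
  HB.pack Y (isMeasurableFun.Build _ _ T (measurableTypeR R) Y mY).
pose nu0 : {charge set (measurableTypeR R) -> \bar R} :=
  pushforward (induced_charge iX) Ym.
pose nu : {charge set (measurableTypeR R) -> \bar R} := nu0 (measurable_funPT Ym).
pose mu : probability (measurableTypeR R) R := distribution P Ym.
have dom : nu `<< mu.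
  apply: (@dominates_pushforward _ _ _ _ _ P (induced_charge iX) Ym) => //.
  apply/null_content_dominatesP => A mA PA.
  by apply: null_set_integral => //; apply: measurable_funTS; exact: (measurable_int P).
pose w0 := Radon_Nikodym nu mu.
have w0fin u : w0 u \is a fin_num by exact: Radon_Nikodym_fin_num.
have iw0 : mu.-integrable setT w0 by exact: Radon_Nikodym_integrable.
have mw0 : measurable_fun setT w0 by exact: (measurable_int mu).
have mw : measurable_fun setT (fine \o w0) by exact: (measurableT_comp _ mw0).
have iwY : P.-integrable setT (EFin \o (fine \o w0 \o Y)).
  apply/integrableP; split; first by apply/measurable_EFinP; exact: measurableT_comp.
  have /integrableP[_] := iw0; apply: le_lt_trans.
  rewrite (_ : \int[mu]_x _ = \int[P]_t `|w0 (Y t)|)%E.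
    rewrite le_eqVlt; apply/orP; left; apply/eqP/eq_integral => t _.
    by congr abse; exact: fineK.
  apply: (ge0_integral_pushforward (measurable_funPT Ym)) => //.
  exact: measurableT_comp.
exists (fine \o w0); split => // A mA.
have := Radon_Nikodym_integral dom mA.
rewrite -[LHS]/(\int[P]_(t in Y @^-1` A) (X t)%:E)%E => ->.
rewrite (_ : \int[mu]_(x in A) _ = \int[P]_(t in Y @^-1` A) (w0 (Y t)))%E.
  by apply: eq_integral => t _; rewrite /= fineK.
apply: (integral_pushforward (measurable_funPT Ym)) => //.
apply: (integrableS measurableT) => //.
  by rewrite -[X in measurable X]setTI; exact: (measurable_funPT Ym).
by apply: eq_integrable iwY => // t _ /=; rewrite fineK.
Qed.

(** The factor [w \o Y] is a version, so [xget] does not fall back on its default. *)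
Lemma cond_exp_is_cond_exp : is_cond_exp P (sigma_gen Y) X (cond_exp P X Y).
Proof.
have [w [mw iw wE]] := cond_exp_factor.
rewrite /cond_exp; case: xgetP => // /(_ (w \o Y)) []; split => //.
  move=> V mV; exists (w @^-1` V); last by rewrite setTI.
  by rewrite -[X in measurable X]setTI; exact: mw.
by move=> _ [A mA <-]; rewrite setTI; exact: wE.
Qed.

(** [T] with the sigma-algebra generated by [Y]. The chosen version is measurable on this space, so
    optimality is applied with the identity into [Ty] as observation. *)
Let Ty := g_sigma_algebra_preimageType (Y : T -> measurableTypeR R).

Let mcond : measurable_fun (setT : set Ty) (cond_exp P X Y).
Proof.
by have [mW _ _] := cond_exp_is_cond_exp; move=> _ V mV; rewrite setTI; exact: mW.
Qed.

Let mid : measurable_fun setT (id : T -> Ty).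
Proof.
by move=> _ _ [A mA <-]; rewrite !setTI -[X in measurable X]setTI; exact: mY.
Qed.

Let mcomp (h : R -> R) : measurable_fun setT h ->
  measurable_fun (setT : set Ty) (h \o Y).
Proof.
move=> mh _ V mV; exists (h @^-1` V); last by rewrite setTI.
by rewrite -[X in measurable X]setTI; exact: mh.
Qed.

Lemma cond_mse_le (h : R -> R) : measurable_fun setT h ->
  ((cond_mse P X Y)%:E <= \int[P]_t ((h (Y t) - X t) ^+ 2)%:E)%E.
Proof.
move=> mh; have [_ iW WE] := cond_exp_is_cond_exp.
(* [fine] sends an infinite expectation to 0, which only lowers the left side. *)
apply: (@le_trans _ _ (\int[P]_t ((cond_exp P X Y t - X t) ^+ 2)%:E)%E).
  rewrite /cond_mse expectation.unlock.
  have : (0 <= \int[P]_t ((cond_exp P X Y t - X t) ^+ 2)%:E)%E.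
    by apply: integral_ge0 => t _; rewrite lee_fin sqr_ge0.
  by case: integral => [r|_|//] => //=; rewrite leey.
exact: (@le_integral_cond_exp_sqr _ _ T Ty R P id mid X _ (h \o Y)
  iX iW mcond (mcomp _ mh) WE).
Qed.

(** [w \o Y] and the chosen version both minimise the error, so their errors agree; comparison with
    the estimator 0 makes it finite. A Borel [w] can later be evaluated at other observations. *)
Lemma cond_mse_attained : (\int[P]_t ((X t) ^+ 2)%:E < +oo)%E ->
  exists2 w : R -> R, measurable_fun setT w &
    (\int[P]_t ((w (Y t) - X t) ^+ 2)%:E)%E = (cond_mse P X Y)%:E.
Proof.
move=> X2; have [_ iW WE] := cond_exp_is_cond_exp.
have [w [mw iw wE]] := cond_exp_factor.
exists w => //.
have E : (\int[P]_t ((w (Y t) - X t) ^+ 2)%:E =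
          \int[P]_t ((cond_exp P X Y t - X t) ^+ 2)%:E)%E.
  apply/eqP; rewrite eq_le; apply/andP; split.
    apply: (@le_integral_cond_exp_sqr _ _ T Ty R P id mid X (w \o Y) _
      iX iw (mcomp _ mw) mcond).
    by move=> _ [A mA <-]; rewrite setTI; exact: wE.
  exact: (@le_integral_cond_exp_sqr _ _ T Ty R P id mid X _ (w \o Y)
    iX iW mcond (mcomp _ mw) WE).
rewrite E /cond_mse expectation.unlock fineK//.
rewrite ge0_fin_numE; last by apply: integral_ge0 => t _; rewrite lee_fin sqr_ge0.
apply: le_lt_trans X2.
have := @le_integral_cond_exp_sqr _ _ T Ty R P id mid X _ (cst 0) iX iW mcond
  (measurable_cst _) WE.
by under [X in (_ <= X)%E -> _]eq_integral do rewrite /= sub0r sqrrN.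
Qed.

End conditional_mse.

(** * The channel map *)

Section compact_support.
Context {R : realType} (mu : law R) (a b : R).
Hypotheses (hsupp : mu `[a, b]%classic = 1%E).

Let suppC : mu (~` `[a, b]%classic) = 0%E.
Proof. by rewrite probability_setC ?hsupp ?subee//; exact: measurable_itv. Qed.

Lemma supp_integrable (f : R -> R) (M : R) : measurable_fun setT f ->
  (forall s, a <= s <= b -> `|f s| <= M) -> mu.-integrable setT (EFin \o f).
Proof.
move=> mf fM; apply/integrableP; split; first exact/measurable_EFinP.
apply: (@le_lt_trans _ _ (\int[mu]_x `|M|%:E)%E); last first.
  by rewrite integral_cst//= probability_setT mule1 ltry.
apply: ae_ge0_le_integral => //.
- by apply/measurable_EFinP; exact: measurableT_comp.
- exists (~` `[a, b]%classic); split => //.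
    by apply: measurableC; exact: measurable_itv.
  move=> s; apply: contra_not => /=; rewrite in_itv => /fM fsM _ /=.
  by rewrite lee_fin (le_trans fsM)// ler_norm.
Qed.

Lemma supp_le_expectation (f g : R -> R) :
  mu.-integrable setT (EFin \o f) -> mu.-integrable setT (EFin \o g) ->
  (forall s, a <= s <= b -> f s <= g s) ->
  fine 'E_mu[f] <= fine 'E_mu[g].
Proof.
move=> intf intg fg; rewrite expectation.unlock.
have mab : measurable (`[a, b]%classic : set (measurableTypeR R)) by exact: measurable_itv.
apply: fine_le; [exact: integrable_fin_num|exact: integrable_fin_num|].
rewrite (negligible_integral (measurableC mab) _ intf)//.
rewrite [leRHS](negligible_integral (measurableC mab) _ intg)// setTD setCK.
apply: le_integral => //; [exact: integrableS intf|exact: integrableS intg|].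
by move=> s /set_mem /=; rewrite in_itv lee_fin => /fg.
Qed.

Lemma supp_expectation_affine (f : R -> R) (p q : R) :
  mu.-integrable setT (EFin \o f) ->
  fine 'E_mu[fun s => p + q * f s] = p + q * fine 'E_mu[f].
Proof.
move=> intf; rewrite expectation.unlock.
under eq_integral do rewrite EFinD EFinM.
rewrite integralD//=; last 2 first.
- exact: finite_measure_integrable_cst.
- exact: integrableZl.
rewrite integral_cst//= probability_setT mule1 integralZl//.
rewrite fineD ?fineM//.
- exact: integrable_fin_num.
- by rewrite fin_numM// integrable_fin_num.
Qed.

End compact_support.

(** [powR] is measurable but agrees with the inverse only on nonnegative reals, whence the detour
    through [x ^+ 2]. *)
Lemma measurable_invr (R : realType) : measurable_fun setT (@GRing.inv R).
Proof.
rewrite (_ : @GRing.inv R = fun x => x * ((@powR R ^~ (-1)) \o (fun y => y ^+ 2)) x).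
  apply: (@measurable_funM _ _ _ setT id ((@powR R ^~ (-1)) \o (fun y => y ^+ 2))) => //.
  apply: measurableT_comp; first exact: measurable_powR.
  exact: measurable_funX.
apply/funext => x; rewrite /= powR_inv1 ?sqr_ge0//.
have [->|x0] := eqVneq x 0; first by rewrite invr0 mul0r.
by field.
Qed.

Lemma measurable_frac {R : realType} (s2 : R) (f : R -> R) (w : R) :
  measurable_fun setT f -> measurable_fun setT (fun s : R => f s / (s2 + w * s)).
Proof.
move=> mf; apply: measurable_funM => //.
apply: (measurableT_comp (@measurable_invr R)).
by apply: measurable_funD => //; exact: mulrl_measurable.
Qed.

Section Lmap.
Context {R : realType} (mu : law R) (a b s2 sbar : R).
Hypotheses (hsupp : mu `[a, b]%classic = 1%E)
  (hmean : ('E_mu[fun s => s] = sbar%:E)%E)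
  (ha : 0 <= a) (has : a < sbar) (hsb : sbar < b) (hs2 : 0 < s2).

Definition Bmap (w : R) : R := fine 'E_mu[fun s => s / (s2 + w * s)].

Let den_gt0 (w s : R) : 0 <= w -> a <= s <= b -> 0 < s2 + w * s.
Proof.
move=> w0 /andP[as_ _]; rewrite ltr_pwDl// mulr_ge0//.
exact: le_trans as_.
Qed.

Let ifrac (w : R) : 0 <= w ->
  mu.-integrable setT (EFin \o (fun s : R => s / (s2 + w * s))).
Proof.
move=> w0; apply: (@supp_integrable _ _ _ _ hsupp _ (b / s2)).
  exact: (measurable_frac s2 id).
move=> s sab; have d0 := den_gt0 _ _ w0 sab; have /andP[as_ sb] := sab.
have s0 : 0 <= s by exact: le_trans as_.
rewrite ger0_norm ?divr_ge0 ?(ltW d0)//.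
rewrite ler_pdivrMr// mulrAC ler_pdivlMr//.
have : 0 <= w * s by rewrite mulr_ge0.
by nra.
Qed.

Let iid : mu.-integrable setT (EFin \o id).
Proof.
apply: (@supp_integrable _ _ _ _ hsupp _ b) => // s /andP[as_ sb].
by rewrite ger0_norm// (le_trans ha).
Qed.

Let sbar0 : 0 < sbar. Proof. exact: le_lt_trans has. Qed.

Let affE (f : R -> R) (p q : R) : mu.-integrable setT (EFin \o f) ->
  fine 'E_mu[fun s => p + q * f s] = p + q * fine 'E_mu[f].
Proof. by move=> intf; exact: supp_expectation_affine. Qed.

Let aff_int (f : R -> R) (p q : R) : mu.-integrable setT (EFin \o f) ->
  mu.-integrable setT (EFin \o (fun s => p + q * f s)).
Proof.
move=> intf.
have ip : mu.-integrable setT (EFin \o cst p) by exact: finite_measure_integrable_cst.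
exact: (integrableD measurableT ip (integrableZl measurableT q intf)).
Qed.

Lemma Bmap0 : Bmap 0 = sbar / s2.
Proof.
rewrite /Bmap (_ : (fun s => _) = (fun s => 0 + s2^-1 * id s)).
  by rewrite affE// add0r mulrC hmean.
by apply/funext => s; rewrite mul0r addr0 add0r mulrC.
Qed.

(** Bounding [s] by [b] in the denominator is crude, but yields both the positivity of [Bmap] and
    the growth bound [Lmap_le]. *)
Lemma Bmap_ge w : 0 <= w -> sbar / (s2 + w * b) <= Bmap w.
Proof.
move=> w0; have E := affE id 0 ((s2 + w * b)^-1) iid.
rewrite hmean /= add0r in E; rewrite [leLHS]mulrC -E [leRHS]/Bmap.
apply: (supp_le_expectation _ _ _ hsupp); [exact: aff_int|exact: ifrac|].
move=> s sab; rewrite add0r mulrC /=; have /andP[as_ sb] := sab.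
apply: ler_wpM2l; first exact: le_trans as_.
rewrite lef_pV2 ?posrE ?den_gt0 ?lerD2l ?ler_wpM2l//.
by rewrite lexx (le_trans as_).
Qed.

Lemma Bmap_gt0 w : 0 <= w -> 0 < Bmap w.
Proof.
move=> w0; apply: lt_le_trans (Bmap_ge _ w0); rewrite divr_gt0//.
by rewrite den_gt0// lexx ltW// (lt_trans has).
Qed.

(** For [w > 0] the numerator of [Lmap] is [w - w ^+ 2 * Bmap w] and its denominator is
    [w * Bmap w]; the value prescribed at 0 fits the same formula. *)
Lemma LmapE w : 0 <= w -> Lmap s2 mu w = (Bmap w)^-1 - w.
Proof.
rewrite /Lmap le_eqVlt => /predU1P[<-|w0].
  by rewrite eqxx hmean Bmap0 invf_div subr0.
rewrite gt_eqF//.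
have -> : fine 'E_mu[fun s => w * s / (s2 + w * s)] = w * Bmap w.
  rewrite (_ : (fun s => _) = (fun s => 0 + w * (s / (s2 + w * s)))).
    by rewrite affE ?add0r//; exact/ifrac/ltW.
  by apply/funext => s; rewrite add0r mulrA.
have -> : fine 'E_mu[fun s => s2 * w / (s2 + w * s)] = w - w ^+ 2 * Bmap w.
  rewrite -mulNr -affE; last exact/ifrac/ltW.
  have is2 : mu.-integrable setT (EFin \o (fun s : R => s2 * w / (s2 + w * s))).
    apply: (@supp_integrable _ _ _ _ hsupp _ w).
      exact: (measurable_frac s2 (cst (s2 * w))).
    move=> s sab; have d0 := den_gt0 _ _ (ltW w0) sab; have /andP[as_ sb] := sab.
    rewrite ger0_norm; last by rewrite divr_ge0 ?(ltW d0)// mulr_ge0 ?ltW.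
    have s0 : 0 <= s by exact: le_trans as_.
    by rewrite ler_pdivrMr// mulrDr mulrC lerDl !mulr_ge0 ?(ltW w0).
  have E s : a <= s <= b ->
      s2 * w / (s2 + w * s) = w + - w ^+ 2 * (s / (s2 + w * s)).
    by move=> sab; field; rewrite gt_eqF// den_gt0// ltW.
  (* The identity [E] holds on [[a, b]] only, so the equality of expectations is split into two
     comparisons on the support. *)
  by apply/eqP; rewrite eq_le; apply/andP; split;
    apply: (supp_le_expectation _ _ _ hsupp) => //; rewrite ?aff_int ?ifrac ?ltW//;
    move=> s /E ->.
have := Bmap_gt0 _ (ltW w0) => B0.
by field; rewrite !gt_eqF.
Qed.

(* Tangent line at [Bmap w] of the concave map [t |-> t / (1 + d * t)]. *)
Lemma Bmap_add w d : 0 <= w -> 0 <= d ->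
  Bmap (w + d) <= Bmap w / (1 + d * Bmap w).
Proof.
move=> w0 d0; set t0 := Bmap w; have t00 : 0 < t0 by exact: Bmap_gt0.
have D0 : 0 < 1 + d * t0 by rewrite ltr_pwDl// mulr_ge0// ltW.
(* With [t = s / (s2 + w * s)], the integrand of [Bmap (w + d)] is [t / (1 + d * t)]. The right side
   is its tangent at [t0], evaluated at the mean [t0] of [t]. *)
have -> : t0 / (1 + d * t0) =
    d * t0 ^+ 2 / (1 + d * t0) ^+ 2 + (1 + d * t0) ^- 2 * t0.
  by field; rewrite gt_eqF.
have Et : t0 = fine 'E_mu[fun s => s / (s2 + w * s)] by [].
rewrite [X in _ + _ * X]Et -affE; last exact: ifrac.
rewrite [leLHS]/Bmap.
apply: (supp_le_expectation _ _ _ hsupp); [exact/ifrac/addr_ge0|exact/aff_int/ifrac|].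
move=> s sab; have e0 := den_gt0 _ _ w0 sab.
have e1 := den_gt0 _ _ (addr_ge0 w0 d0) sab.
rewrite -/t0 -subr_ge0.
have -> : d * t0 ^+ 2 / (1 + d * t0) ^+ 2 + (1 + d * t0) ^- 2 * (s / (s2 + w * s))
    - s / (s2 + (w + d) * s) =
  d * (t0 * (s2 + w * s) - s) ^+ 2 /
    ((1 + d * t0) ^+ 2 * (s2 + w * s) * (s2 + (w + d) * s)).
  by field; rewrite !gt_eqF.
apply: divr_ge0; apply: mulr_ge0 => //; [exact: sqr_ge0| |exact: ltW].
by rewrite mulr_ge0 ?sqr_ge0 ?(ltW e0).
Qed.

(** Inverted, [Bmap_add] says that [1 / Bmap] grows by at least [d] from [w] to [w + d], which
    outweighs the term [- w]. *)
Lemma Lmap_homo w1 w2 : 0 <= w1 -> w1 <= w2 -> Lmap s2 mu w1 <= Lmap s2 mu w2.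
Proof.
move=> w10 w12; have w20 := le_trans w10 w12.
rewrite !LmapE//.
have d0 : 0 <= w2 - w1 by rewrite subr_ge0.
have := Bmap_add _ _ w10 d0; rewrite subrKC.
have B1 := Bmap_gt0 _ w10; have B2 := Bmap_gt0 _ w20.
rewrite -lef_pV2 ?posrE ?divr_gt0 ?ltr_pwDl ?mulr_ge0 ?(ltW B1)// invf_div.
rewrite mulrDl mul1r mulfK ?gt_eqF//.
by lra.
Qed.

Lemma Lmap_le w : 0 <= w -> Lmap s2 mu w <= (s2 + w * b) / sbar.
Proof.
move=> w0; rewrite LmapE//.
have b0 : 0 < s2 + w * b by rewrite den_gt0// lexx ltW// (lt_trans has).
have : (Bmap w)^-1 <= (s2 + w * b) / sbar.
  by rewrite -[leRHS]invf_div lef_pV2 ?posrE ?Bmap_gt0 ?divr_gt0// Bmap_ge.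
by lra.
Qed.

(** Monotonicity from the value at 0. Since [Lmap] of [point_mass sbar] is constantly [s2 / sbar],
    this is also the lower half of the comparison of laws. *)
Lemma Lmap_ge w : 0 <= w -> s2 / sbar <= Lmap s2 mu w.
Proof.
move=> w0; rewrite -[leLHS]invf_div -Bmap0 -[leLHS]subr0 -LmapE//.
exact: Lmap_homo.
Qed.

(** A concave function lies above its chord. The mean of the chord depends on [mu] only through
    [sbar], and it equals the value of [Bmap] at the two-point law. *)
Lemma Bmap_chord w : 0 <= w ->
  (b - sbar) / (b - a) * (a / (s2 + w * a)) + (sbar - a) / (b - a) * (b / (s2 + w * b))
  <= Bmap w.
Proof.
move=> w0; have ab : a < b by exact: lt_trans hsb.
set fa := a / _; set fb := b / _.
have -> : (b - sbar) / (b - a) * fa + (sbar - a) / (b - a) * fb =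
    (b * fa - a * fb) / (b - a) + (fb - fa) / (b - a) * sbar.
  by field; rewrite subr_eq0 gt_eqF.
have := affE id ((b * fa - a * fb) / (b - a)) ((fb - fa) / (b - a)) iid.
rewrite hmean /= => <-; rewrite [leRHS]/Bmap.
apply: (supp_le_expectation _ _ _ hsupp); [exact: aff_int|exact: ifrac|].
move=> s sab; have e0 := den_gt0 _ _ w0 sab; have /andP[as_ sb] := sab.
have ea : 0 < s2 + w * a by rewrite den_gt0// lexx ltW.
have eb : 0 < s2 + w * b by rewrite den_gt0// lexx ltW.
rewrite -subr_ge0 /fa /fb.
have -> : s / (s2 + w * s) - ((b * (a / (s2 + w * a)) - a * (b / (s2 + w * b))) / (b - a) +
    (b / (s2 + w * b) - a / (s2 + w * a)) / (b - a) * s) =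
  w * s2 * (s - a) * (b - s) / ((s2 + w * s) * (s2 + w * a) * (s2 + w * b)).
  by field; rewrite !gt_eqF ?subr_gt0.
apply: divr_ge0; last by rewrite !mulr_ge0 ?(ltW e0) ?(ltW ea) ?(ltW eb).
by rewrite !mulr_ge0 ?subr_ge0 ?(ltW hs2).
Qed.

End Lmap.

(** * The mmse as a function of the noise variance *)

Section mmse.
Context {R : realType} (pi : law R).
Hypothesis hpi : ('E_pi[fun x => (x ^+ 2)%R] < +oo)%E.
Local Notation RR := (measurableTypeR R * measurableTypeR R)%type.
Local Notation Q := (pi \x @gauss R)%E.

Let pi2 : (\int[pi]_x (x ^+ 2)%:E < +oo)%E.
Proof. by move: hpi; rewrite expectation.unlock. Qed.

Let mx2 : measurable_fun setT (fun x : measurableTypeR R => (x ^+ 2)%:E).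
Proof. by apply/measurable_EFinP; exact: measurable_funX. Qed.

Definition second_moment : R := fine (\int[pi]_x (x ^+ 2)%:E)%E.

Let second_momentE : (\int[pi]_x (x ^+ 2)%:E)%E = second_moment%:E.
Proof.
by rewrite fineK// ge0_fin_numE// integral_ge0// => x _; rewrite lee_fin sqr_ge0.
Qed.

Lemma second_moment_ge0 : 0 <= second_moment.
Proof.
by rewrite -lee_fin -second_momentE integral_ge0// => x _; rewrite lee_fin sqr_ge0.
Qed.

Let int_fst2 : (\int[Q]_p (p.1 ^+ 2)%:E = second_moment%:E)%E.
Proof.
rewrite (@fubini_tonelli1 _ _ _ _ R pi gauss (fun p : RR => (p.1 ^+ 2)%:E))//=; last first.
- by move=> p; rewrite lee_fin sqr_ge0.
- by apply: (measurableT_comp mx2).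
rewrite -second_momentE; apply: eq_integral => x _.
by rewrite /fubini_F /= integral_cst//= probability_setT mule1.
Qed.

Let int_fst : Q.-integrable setT (EFin \o (fun p : RR => p.1)).
Proof.
have mf2 : measurable_fun setT (fun p : RR => (p.1 ^+ 2)%:E).
  exact: (measurableT_comp mx2).
have i2 : Q.-integrable setT (fun p : RR => (p.1 ^+ 2)%:E).
  apply/integrableP; split => //.
  under eq_integral do rewrite gee0_abs ?lee_fin ?sqr_ge0//.
  by rewrite int_fst2 ltry.
have i1 : Q.-integrable setT (EFin \o cst 1).
  exact: (@finite_measure_integrable_cst _ _ _ (Q : probability RR R)).
apply: le_integrable (integrableD measurableT i1 i2) => //.
  by apply/measurable_EFinP; exact: measurable_fst.
move=> p _ /=; rewrite lee_fin [leRHS]ger0_norm ?addr_ge0 ?sqr_ge0// ler_norml.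
have := sqr_ge0 (p.1 - 1); have := sqr_ge0 (p.1 + 1).
by rewrite sqrrD sqrrB !expr1n => h1 h2; apply/andP; split; lra.
Qed.

Let mobs tau : measurable_fun setT (fun p : RR => p.1 + Num.sqrt tau * p.2).
Proof. by apply: measurable_funD => //; exact: measurable_funM. Qed.

(** With [mmse_attained], this makes the mmse a minimum over Borel estimators, the only form in
    which it is used from here on. *)
Lemma mmse_le (tau : R) (h : R -> R) : measurable_fun setT h ->
  ((mmse pi tau)%:E <=
   \int[Q]_p ((h (p.1 + Num.sqrt tau * p.2) - p.1) ^+ 2)%:E)%E.
Proof. by move=> mh; exact: (cond_mse_le _ _ _ int_fst (mobs tau) h mh). Qed.

Lemma mmse_attained (tau : R) : exists2 w : R -> R, measurable_fun setT w &
  (\int[Q]_p ((w (p.1 + Num.sqrt tau * p.2) - p.1) ^+ 2)%:E = (mmse pi tau)%:E)%E.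
Proof.
apply: (cond_mse_attained _ _ _ int_fst (mobs tau)).
by rewrite int_fst2 ltry.
Qed.

Lemma mmse_ge0 tau : 0 <= mmse pi tau.
Proof.
have [w _ E] := mmse_attained tau.
by rewrite -lee_fin -E integral_ge0// => x _; rewrite lee_fin sqr_ge0.
Qed.

(** The right side bounds the error of the linear estimator [c * y]: a bias [(1 - c) x] and an
    independent noise of variance [c ^+ 2 * tau]. *)
Lemma mmse_le_linear (tau c : R) : 0 <= tau ->
  mmse pi tau <= (1 - c) ^+ 2 * second_moment + c ^+ 2 * tau.
Proof.
move=> tau0; rewrite -lee_fin.
have mh : measurable_fun setT ( *%R c : R -> R) by exact: mulrl_measurable.
apply: le_trans (mmse_le tau _ mh) _.
pose f (p : RR) := ((c * (p.1 + Num.sqrt tau * p.2) - p.1) ^+ 2)%:E.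
have mf : measurable_fun setT f.
  apply/measurable_EFinP; apply: measurable_funX; apply: measurable_funB => //.
  by apply: measurable_funM.
have f0 p : (0 <= f p)%E by rewrite lee_fin sqr_ge0.
rewrite (@fubini_tonelli1 _ _ _ _ R pi gauss f)//=.
apply: (@le_trans _ _ (\int[pi]_x (((1 - c) ^+ 2)%:E * (x ^+ 2)%:E + (c ^+ 2 * tau)%:E))%E).
  apply: ge0_le_integral => //.
  - by move=> x _; apply: integral_ge0 => z _; rewrite lee_fin sqr_ge0.
  - exact: measurable_fun_fubini_tonelli_F.
  - by apply: emeasurable_funD => //; apply: measurable_funeM.
  - move=> x _; rewrite /fubini_F /f /=.
    have := @gauss_affine_sqr_le R (- (1 - c) * x) (c * Num.sqrt tau).
    rewrite exprMn sqrrN exprMn sqr_sqrtr// EFinD EFinM.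
    apply: le_trans; rewrite le_eqVlt; apply/orP; left; apply/eqP.
    by apply: eq_integral => z _; congr (_ ^+ 2)%:E; ring.
rewrite ge0_integralD//; last 3 first.
- by move=> x _; rewrite -EFinM lee_fin mulr_ge0 ?sqr_ge0.
- exact: measurable_funeM.
- by move=> x _; rewrite lee_fin mulr_ge0 ?sqr_ge0.
rewrite ge0_integralZl//; last 2 first.
- by move=> x _; rewrite lee_fin sqr_ge0.
- by rewrite lee_fin sqr_ge0.
by rewrite second_momentE integral_cst//= probability_setT mule1 -EFinM -EFinD.
Qed.

(* Write Y1 = B* + s1 Z.  Adding fresh noise sd Z' to Y1 gives an observation of
   variance t2, and Y1 - (s1^2 / sd) Z' is B* plus a noise of variance
   t1 t2 / (t2 - t1) independent of the former.  For each fixed value z' of Z'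
   their combination is a function of Y1 alone, so it competes with the mmse at
   t1; one then averages over z'. *)
Lemma mmse_le_combine (t1 t2 c : R) : 0 < t1 -> t1 < t2 ->
  mmse pi t1 <= (1 - c) ^+ 2 * mmse pi t2 + c ^+ 2 * (t1 * t2 / (t2 - t1)).
Proof.
move=> t10 t12; rewrite -lee_fin; have t20 := lt_trans t10 t12.
have d0 : 0 < t2 - t1 by rewrite subr_gt0.
set s1 := Num.sqrt t1; set s2 := Num.sqrt t2; pose sd := Num.sqrt (t2 - t1).
have s10 : 0 < s1 by rewrite sqrtr_gt0.
have s20 : 0 < s2 by rewrite sqrtr_gt0.
have sd0 : 0 < sd by rewrite sqrtr_gt0.
have s1E : s1 ^+ 2 = t1 by rewrite sqr_sqrtr// ltW.
have s2E : s2 ^+ 2 = t2 by rewrite sqr_sqrtr// ltW.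
have sdE : sd ^+ 2 = t2 - t1 by rewrite sqr_sqrtr// ltW.
have [w mw wE] := mmse_attained t2.
pose h (z' y : R) := (1 - c) * w (y + sd * z') + c * (y - s1 ^+ 2 / sd * z').
have mh z' : measurable_fun setT (h z').
  apply: measurable_funD; apply: measurable_funM => //.
    by apply: (measurableT_comp mw); exact: measurable_funD.
  exact: measurable_funB.
pose f (p : RR) (z' : measurableTypeR R) := ((h z' (p.1 + s1 * p.2) - p.1) ^+ 2)%:E.
have f0 p z' : (0 <= f p z')%E by rewrite lee_fin sqr_ge0.
have mf : measurable_fun setT (fun q : RR * measurableTypeR R => f q.1 q.2).
  have my : measurable_fun setT (fun q : RR * measurableTypeR R => q.1.1 + s1 * q.1.2).
    by apply: (measurableT_comp (f := fun p : RR => p.1 + s1 * p.2)); first exact: mobs.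
  have mz (k : R) : measurable_fun setT (fun q : RR * measurableTypeR R => k * q.2).
    exact: measurable_funM.
  apply/measurable_EFinP; apply: measurable_funX; apply: measurable_funB; last first.
    exact: (measurableT_comp measurable_fst).
  apply: measurable_funD; apply: measurable_funM => //.
    by apply: (measurableT_comp mw); exact: measurable_funD.
  exact: measurable_funB.
have step1 : ((mmse pi t1)%:E <= \int[@gauss R]_z' \int[Q]_p f p z')%E.
  rewrite -[leLHS]mule1 -(@probability_setT _ _ _ (@gauss R)) -integral_cst//.
  apply: ge0_le_integral => //.
  - by move=> z' _; rewrite lee_fin mmse_ge0.
  - exact: (@measurable_fun_fubini_tonelli_G _ _ _ _ _
      (Q : probability RR R) (fun q => f q.1 q.2)).
  - by move=> z' _; exact: (mmse_le t1 (h z') (mh z')).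
(* Tonelli moves [x] outermost, so that the rotation acts on [(z, z')] with [x] fixed. *)
have step2 : (\int[@gauss R]_z' \int[Q]_p f p z' =
    \int[pi]_x \int[@gauss R]_z \int[@gauss R]_z' f (x, z) z')%E.
  rewrite -(@fubini_tonelli _ _ _ _ _ (Q : probability RR R) gauss (fun q => f q.1 q.2))//.
  rewrite (@fubini_tonelli1 _ _ _ _ R pi gauss (fun p => \int[gauss]_z' f p z')%E)//.
  - exact: (@measurable_fun_fubini_tonelli_F _ _ _ _ _ gauss (fun q => f q.1 q.2)).
  - by move=> p; exact: integral_ge0.
have mgg : measurable_fun setT (fun p : RR => ((w (p.1 + s2 * p.2) - p.1) ^+ 2)%:E).
  apply/measurable_EFinP; apply: measurable_funX; apply: measurable_funB => //.
  exact: (measurableT_comp mw (mobs t2)).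
pose g (x u : R) := ((w (x + s2 * u) - x) ^+ 2)%:E.
have g0 x u : (0 <= g x u)%E by rewrite lee_fin sqr_ge0.
have mgx (x : R) : measurable_fun setT (fun u : measurableTypeR R => g x u).
  exact: (measurableT_comp mgg (measurable_pair1 x)).
have step3 x : (\int[@gauss R]_z \int[@gauss R]_z' f (x, z) z' <=
    \int[@gauss R]_u (((1 - c) ^+ 2)%:E * g x u + (c ^+ 2 * (t1 * t2 / (t2 - t1)))%:E))%E.
  (* After the rotation, [q.1] is the normalised noise of the observation of variance [t2] and [q.2]
     that of the second observation, of variance [(s1 * s2 / sd) ^+ 2 = t1 * t2 / (t2 - t1)]. *)
  pose F (q : RR) :=
    (((1 - c) * (w (x + s2 * q.1) - x) + c * (s1 * s2 / sd) * q.2) ^+ 2)%:E.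
  have F0 q : (0 <= F q)%E by rewrite lee_fin sqr_ge0.
  have mF : measurable_fun setT F.
    apply/measurable_EFinP; apply: measurable_funX; apply: measurable_funD.
      apply: measurable_funM => //; apply: measurable_funB => //.
      apply: (measurableT_comp mw); apply: measurable_funD => //.
      exact: measurable_funM.
    exact: measurable_funM.
  have ab : (s1 / s2) ^+ 2 + (sd / s2) ^+ 2 = 1.
    by rewrite !expr_div_n s1E s2E sdE; field; rewrite gt_eqF.
  have b0 : sd / s2 != 0 by rewrite gt_eqF ?divr_gt0.
  have := @ge0_integral_gauss_rotate R (s1 / s2) (sd / s2) F b0 ab mF F0.
  rewrite [X in X = _ -> _](_ : _ =
    \int[@gauss R]_z \int[@gauss R]_z' f (x, z) z')%E; last first.
    apply: eq_integral => z _; apply: eq_integral => z' _.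
    rewrite /F /f /h /=; congr (_ ^+ 2)%:E.
    have -> : x + s2 * (s1 / s2 * z + sd / s2 * z') = x + s1 * z + sd * z'.
      by field; rewrite gt_eqF.
    by field; rewrite !gt_eqF.
  move=> ->; apply: ge0_le_integral => //.
  - by move=> u _; exact: integral_ge0.
  - exact: measurable_fun_fubini_tonelli_F.
  - by apply: emeasurable_funD => //; exact: measurable_funeM.
  - move=> u _; rewrite /F /=.
    apply: le_trans (gauss_affine_sqr_le _ _) _.
    rewrite EFinD; apply: leeD; first by rewrite exprMn EFinM.
    by rewrite lee_fin exprMn expr_div_n exprMn s1E s2E sdE.
apply: le_trans step1 _; rewrite step2.
pose gI (x : R) := (\int[@gauss R]_u g x u)%E.
have mgI : measurable_fun setT gI.
  exact: (@measurable_fun_fubini_tonelli_F _ _ _ _ _ gauss (fun p => g p.1 p.2)).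
apply: (@le_trans _ _ (\int[pi]_x
  (((1 - c) ^+ 2)%:E * gI x + (c ^+ 2 * (t1 * t2 / (t2 - t1)))%:E))%E).
  apply: ge0_le_integral => //.
  - by move=> x _; apply: integral_ge0 => z _; exact: integral_ge0.
  - apply: (@measurable_fun_fubini_tonelli_F _ _ _ _ _ gauss
      (fun p : RR => \int[gauss]_z' f p z')%E) => //.
      exact: (@measurable_fun_fubini_tonelli_F _ _ _ _ _ gauss (fun q => f q.1 q.2)).
    by move=> p; exact: integral_ge0.
  - by apply: emeasurable_funD => //; exact: measurable_funeM.
  - move=> x _; apply: le_trans (step3 x) _.
    rewrite ge0_integralD//.
    + by rewrite ge0_integralZl ?lee_fin ?sqr_ge0// ?integral_cst//= ?probability_setT ?mule1.
    + by move=> u _; rewrite mule_ge0 ?lee_fin ?sqr_ge0.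
    + exact: measurable_funeM.
    + by move=> u _; rewrite lee_fin mulr_ge0 ?sqr_ge0// divr_ge0 ?mulr_ge0 ?ltW.
rewrite ge0_integralD//.
- rewrite ge0_integralZl ?lee_fin ?sqr_ge0// ?integral_cst//= ?probability_setT ?mule1//.
  + rewrite -(_ : (mmse pi t2)%:E = \int[pi]_x gI x)%E ?EFinD ?EFinM//.
    by rewrite -wE (@fubini_tonelli1 _ _ _ _ R pi gauss (fun p : RR => g p.1 p.2)).
  + by move=> x _; exact: integral_ge0.
- by move=> x _; rewrite mule_ge0 ?lee_fin ?sqr_ge0// integral_ge0.
- exact: measurable_funeM.
- by move=> x _; rewrite lee_fin mulr_ge0 ?sqr_ge0// divr_ge0 ?mulr_ge0 ?ltW.
Qed.

End mmse.
(** * Greatest fixed points *)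

Section tarski.
Context {R : realType}.

Lemma setmaxE (A : set R) (x : R) : maxima A x -> setmax A = x.
Proof.
move=> Ax; apply: xget_subset1 => // y z [Ay uy] [Az uz].
by apply/eqP; rewrite eq_le uz ?uy.
Qed.

(** The bound [l] makes [S] nonempty and [M] bounds it. Domination of every [x <= h x], and not just
    of fixed points, is what later compares two maps. *)
Lemma greatest_fixed_point (h : R -> R) (l M : R) : 0 < l ->
  (forall x y, 0 < x -> x <= y -> h x <= h y) ->
  (forall x, 0 < x -> l <= h x) ->
  (forall x, 0 < x -> x <= h x -> x <= M) ->
  exists t, [/\ maxima [set x | 0 < x /\ h x = x] t, 0 < t &
    forall x, 0 < x -> x <= h x -> x <= t].
Proof.
move=> l0 hh hl hM; pose S := [set x | 0 < x /\ x <= h x].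
have Sl : S l by split => //; exact: hl.
have hS : has_sup S.
  by split; [exists l|exists M => x [x0 xh]; exact: hM].
have ubS x : S x -> x <= sup S by move=> Sx; exact: (sup_upper_bound hS).
have t0 : 0 < sup S by apply: lt_le_trans (ubS _ Sl).
have th : sup S <= h (sup S).
  apply: ge_sup; first by exists l.
  move=> x [x0 xh]; have xt := ubS _ (conj x0 xh).
  by apply: le_trans xh _; exact: hh.
exists (sup S); split => //; last by move=> x x0 xh; exact: (ubS _ (conj x0 xh)).
split; last by move=> x [x0 xh]; apply: ubS; split => //; rewrite xh.
(* By monotonicity [h (sup S)] lies in [S] too, hence is at most [sup S]. *)
split => //; apply/eqP; rewrite eq_le th andbT; apply: ubS; split.
  exact: lt_le_trans th.
exact: hh.
Qed.

End tarski.

(** * Monotonicity and bounds for the extrinsic error *)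

Section extrinsic.
Context {R : realType} (pi : law R).
Hypothesis hpi : ('E_pi[fun x => (x ^+ 2)%R] < +oo)%E.
Local Notation V := (second_moment pi).

Lemma mmse_le_second_moment tau : 0 <= tau -> mmse pi tau <= V.
Proof.
move=> t0; have := mmse_le_linear _ hpi _ 0 t0.
by rewrite subr0 expr1n mul1r expr0n /= mul0r addr0.
Qed.

(** The optimal linear weight [V / (V + tau)] gives the error [V * tau / (V + tau)]. The strict
    bound keeps the denominator of [extrinsic] positive. *)
Lemma mmse_lt tau : 0 < tau -> mmse pi tau < tau.
Proof.
move=> t0; have V0 := second_moment_ge0 _ hpi.
have Vt : 0 < V + tau by rewrite ltr_wpDl.
apply: le_lt_trans (mmse_le_linear _ hpi _ (V / (V + tau)) (ltW t0)) _.
rewrite -subr_gt0.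
have -> : tau - ((1 - V / (V + tau)) ^+ 2 * V + (V / (V + tau)) ^+ 2 * tau) =
    tau ^+ 2 / (V + tau) by field; rewrite gt_eqF.
by rewrite divr_gt0 ?exprn_gt0.
Qed.

(* The optimal weight [c = m2 / (m2 + k)] in [mmse_le_combine], where
   [k = t1 * t2 / (t2 - t1)] satisfies [1 / k = 1 / t1 - 1 / t2]. *)
Lemma mmse_precision t1 t2 : 0 < t1 -> t1 < t2 ->
  mmse pi t1 * (t1 * t2 + mmse pi t2 * (t2 - t1)) <= mmse pi t2 * (t1 * t2).
Proof.
move=> t10 t12; have t20 := lt_trans t10 t12.
have d0 : 0 < t2 - t1 by rewrite subr_gt0.
set m2 := mmse pi t2; have m20 : 0 <= m2 := mmse_ge0 _ hpi _.
have tt : 0 < t1 * t2 by rewrite mulr_gt0.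
have D0 : 0 < t1 * t2 + m2 * (t2 - t1) by rewrite ltr_pwDl// mulr_ge0// ltW.
rewrite -ler_pdivlMr//.
apply: le_trans (mmse_le_combine _ hpi _ _
  (m2 * (t2 - t1) / (t1 * t2 + m2 * (t2 - t1))) t10 t12) _.
rewrite -/m2 le_eqVlt; apply/orP; left; apply/eqP.
by field; rewrite !gt_eqF.
Qed.

Lemma mmse_homo t1 t2 : 0 < t1 -> t1 <= t2 -> mmse pi t1 <= mmse pi t2.
Proof.
move=> t10; rewrite le_eqVlt => /predU1P[<-//|t12].
have t20 := lt_trans t10 t12; have m20 := mmse_ge0 _ hpi t2.
have tt : 0 < t1 * t2 by rewrite mulr_gt0.
rewrite -(ler_pM2r tt); apply: le_trans (mmse_precision _ _ t10 t12).
by rewrite ler_wpM2l ?(mmse_ge0 _ hpi)// lerDl mulr_ge0// subr_ge0 ltW.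
Qed.

Lemma extrinsicE tau : 0 < tau ->
  extrinsic pi tau = mmse pi tau * tau / (tau - mmse pi tau).
Proof.
move=> t0; have := mmse_lt _ t0; rewrite -subr_gt0 => d0.
by rewrite /extrinsic; field; rewrite !gt_eqF.
Qed.

Lemma extrinsic_ge0 tau : 0 < tau -> 0 <= extrinsic pi tau.
Proof.
move=> t0; rewrite extrinsicE// divr_ge0 ?mulr_ge0 ?(mmse_ge0 _ hpi) ?(ltW t0)//.
by rewrite subr_ge0 ltW// mmse_lt.
Qed.

(** Formally [1 / extrinsic] is [1 / mmse - 1 / tau], and [mmse_precision] says that this does not
    increase; clearing denominators admits a vanishing mmse. *)
Lemma extrinsic_homo t1 t2 : 0 < t1 -> t1 <= t2 ->
  extrinsic pi t1 <= extrinsic pi t2.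
Proof.
move=> t10; rewrite le_eqVlt => /predU1P[<-//|t12].
have t20 := lt_trans t10 t12; have m1 := mmse_lt _ t10; have m2 := mmse_lt _ t20.
rewrite !extrinsicE// ler_pdivrMr ?subr_gt0// mulrAC ler_pdivlMr ?subr_gt0//.
by have := mmse_precision _ _ t10 t12; nra.
Qed.

(** As [mmse <= V <= tau / 2], the factor [tau / (tau - mmse)] is at most 2. *)
Lemma extrinsic_le tau : 0 < tau -> 2 * V <= tau -> extrinsic pi tau <= 2 * V.
Proof.
move=> t0 Vt; have mt := mmse_lt _ t0; have mV := mmse_le_second_moment _ (ltW t0).
have m0 := mmse_ge0 _ hpi tau.
rewrite extrinsicE// ler_pdivrMr ?subr_gt0//.
by nra.
Qed.

End extrinsic.

(** * Existence and comparison of the greatest Bayes-VAMP fixed points *)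

Section fixed_points.
Context {R : realType} (s2 a b sbar : R).
Hypotheses (hs2 : 0 < s2) (ha : 0 <= a) (has : a < sbar) (hsb : sbar < b).

Lemma ex_greatest_fixed_point (mu : law R) (pi : law R) :
  mu `[a, b]%classic = 1%E -> ('E_mu[fun s => s] = sbar%:E)%E ->
  ('E_pi[fun x => (x ^+ 2)%R] < +oo)%E ->
  exists t, [/\ maxima (fixed_points s2 pi mu) t, 0 < t,
    Lmap s2 mu (extrinsic pi t) = t &
    forall x, 0 < x -> x <= Lmap s2 mu (extrinsic pi x) -> x <= t].
Proof.
move=> hsupp hmean hpi; have sbar0 : 0 < sbar by exact: le_lt_trans has.
have b0 : 0 <= b by rewrite (le_trans (ltW sbar0))// ltW.
pose h x := Lmap s2 mu (extrinsic pi x).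
pose V := second_moment pi; have V0 : 0 <= V := second_moment_ge0 _ hpi.
(* The last argument is a sum covering two cases: either [x <= 2 * V], or [extrinsic_le] and
   [Lmap_le] bound [h x], and so [x], by the second summand. *)
have [|x y x0 xy|x x0|x x0 xh|t [tm t0 tub]] :=
  @greatest_fixed_point _ h (s2 / sbar) (2 * V + (s2 + 2 * V * b) / sbar).
- by rewrite divr_gt0.
- apply: (Lmap_homo _ _ _ _ _ hsupp hmean ha has hsb hs2); first exact: extrinsic_ge0.
  exact: extrinsic_homo.
- apply: (Lmap_ge _ _ _ _ _ hsupp hmean ha has hsb hs2); exact: extrinsic_ge0.
- have c0 : 0 <= (s2 + 2 * V * b) / sbar.
    by rewrite divr_ge0 ?(ltW sbar0)// addr_ge0 ?(ltW hs2)// !mulr_ge0.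
  have [xV|Vx] := leP x (2 * V); first by lra.
  apply: le_trans xh _; rewrite -[leLHS]add0r lerD ?mulr_ge0//.
  have e0 := extrinsic_ge0 _ hpi _ x0.
  apply: le_trans (Lmap_le _ _ _ _ _ hsupp hmean ha has hsb hs2 _ e0) _.
  rewrite ler_pM2r ?invr_gt0// lerD2l ler_wpM2r//.
  by apply: extrinsic_le => //; exact: ltW.
by exists t; split => //; case: tm => -[].
Qed.

(** The greatest fixed point for [mu] satisfies [t <= h t] for the map [h] of [nu], hence lies below
    the greatest fixed point of the latter. *)
Lemma tauBplus_le (mu nu : law R) (pi : law R) :
  mu `[a, b]%classic = 1%E -> ('E_mu[fun s => s] = sbar%:E)%E ->
  nu `[a, b]%classic = 1%E -> ('E_nu[fun s => s] = sbar%:E)%E ->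
  (forall w, 0 <= w -> Lmap s2 mu w <= Lmap s2 nu w) ->
  ('E_pi[fun x => (x ^+ 2)%R] < +oo)%E ->
  tauBplus s2 pi mu <= tauBplus s2 pi nu /\
  mmse pi (tauBplus s2 pi mu) <= mmse pi (tauBplus s2 pi nu).
Proof.
move=> smu mmu snu mnu L hpi.
have [t [tm t0 th _]] := ex_greatest_fixed_point _ _ smu mmu hpi.
have [u [um u0 _ uub]] := ex_greatest_fixed_point _ _ snu mnu hpi.
rewrite /tauBplus (setmaxE _ _ tm) (setmaxE _ _ um).
have tu : t <= u.
  by apply: uub => //; rewrite -{1}th; apply: L; exact: extrinsic_ge0.
by split => //; exact: mmse_homo.
Qed.

End fixed_points.

(** * The two extremal laws: support and expectations *)

Section extremal_laws.
Context {R : realType} (a b sbar : R).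
Hypotheses (has : a < sbar) (hsb : sbar < b).

Let point_massE (x : R) (A : set R) : point_mass x A = (\1_A x)%:E.
Proof. by []. Qed.

Lemma point_mass_supp : point_mass sbar `[a, b]%classic = 1%E.
Proof.
rewrite point_massE indicE mem_set//=.
by rewrite in_itv/= (ltW has) (ltW hsb).
Qed.

Lemma point_mass_expectation (f : R -> R) : measurable_fun setT f ->
  ('E_(point_mass sbar)[f] = (f sbar)%:E)%E.
Proof.
move=> mf; rewrite expectation.unlock integral_dirac//.
  by rewrite diracT mul1e.
exact/measurable_EFinP.
Qed.

Local Notation nu := (two_point has hsb).

Let ba0 : b - a != 0.
Proof. by rewrite subr_eq0 gt_eqF// (lt_trans has). Qed.

Lemma two_point_supp : nu `[a, b]%classic = 1%E.
Proof.
rewrite /two_point measure_addE.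
rewrite -[LHS]/(((b - sbar) / (b - a))%:E * point_mass a `[a, b]%classic
                + ((sbar - a) / (b - a))%:E * point_mass b `[a, b]%classic)%E.
have ab : a <= b by rewrite ltW// (lt_trans has).
rewrite !point_massE !indicE !mem_set /= ?in_itv/= ?lexx ?ab//.
by rewrite !mule1 -EFinD; congr EFin; field.
Qed.

(** The negative part of [f] vanishes at both atoms. Signs are prescribed there only, because
    [s / (s2 + w * s)] may be negative off [[a, b]]. *)
Lemma two_point_expectation (f : R -> R) : measurable_fun setT f ->
  0 <= f a -> 0 <= f b ->
  ('E_nu[f] = ((b - sbar) / (b - a) * f a + (sbar - a) / (b - a) * f b)%:E)%E.
Proof.
move=> mf fa fb; rewrite expectation.unlock.
have ge0E (g : R -> \bar R) : measurable_fun setT g -> (forall x, 0 <= g x)%E ->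
  (\int[nu]_x g x = ((b - sbar) / (b - a))%:E * g a + ((sbar - a) / (b - a))%:E * g b)%E.
  move=> mg g0; rewrite /two_point.
  rewrite ge0_integral_measure_add// !ge0_integral_mscale// !integral_dirac//.
  by rewrite !diracT !mul1e.
have mEf : measurable_fun setT (EFin \o f) by exact/measurable_EFinP.
rewrite integralE !ge0E//; [|exact: measurable_funeneg|exact: measurable_funepos].
have fp x : 0 <= f x -> ((EFin \o f)^\+ x = (f x)%:E)%E.
  by move=> fx; rewrite funeposE; apply/max_idPl; rewrite lee_fin.
have fn x : 0 <= f x -> ((EFin \o f)^\- x = 0)%E.
  by move=> fx; rewrite funenegE; apply/max_idPr; rewrite -EFinN lee_fin oppr_le0.
rewrite !fp// !fn//.
by rewrite !mule0 adde0 sube0 -!EFinM -EFinD.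
Qed.

End extremal_laws.

(** The nonemptiness clauses certify that each [tauBplus] is an attained maximum and not the default
    value of [setmax]. *)
Theorem corollary3p10 (R : realType) (sigma2 : R) (hsigma2 : 0 < sigma2)
    (mu : law R) (a b sbar : R)
    (hsupp : mu `[a, b]%classic = 1%E)
    (hmean : ('E_mu[fun s => s] = sbar%:E)%E)
    (ha : 0 <= a) (has : a < sbar) (hsb : sbar < b) :
  (forall omega : R, 0 < omega ->
     Lmap sigma2 (point_mass sbar) omega <= Lmap sigma2 mu omega
       <= Lmap sigma2 (two_point has hsb) omega)
  /\
  (forall pi : law R, ('E_pi[fun x => (x ^+ 2)%R] < +oo)%E ->
     [/\ maxima (fixed_points sigma2 pi (point_mass sbar)) !=set0,
         maxima (fixed_points sigma2 pi mu) !=set0,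
         maxima (fixed_points sigma2 pi (two_point has hsb)) !=set0,
         tauBplus sigma2 pi (point_mass sbar) <= tauBplus sigma2 pi mu
           <= tauBplus sigma2 pi (two_point has hsb)
       & mmse pi (tauBplus sigma2 pi (point_mass sbar))
           <= mmse pi (tauBplus sigma2 pi mu)
           <= mmse pi (tauBplus sigma2 pi (two_point has hsb))]).
Proof.
have sbar0 : 0 < sbar by exact: le_lt_trans has.
have b0 : 0 <= b by rewrite (le_trans (ltW sbar0))// ltW.
have dsupp := point_mass_supp a b sbar has hsb.
have dmean : ('E_(point_mass sbar)[fun s => s] = sbar%:E)%E.
  exact: point_mass_expectation.
have tsupp := two_point_supp a b sbar has hsb.
have tmean : ('E_(two_point has hsb)[fun s => s] = sbar%:E)%E.
  rewrite two_point_expectation//; congr EFin; field.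
  by rewrite subr_eq0 gt_eqF// (lt_trans has).
have mfrac w := measurable_frac sigma2 id w (@measurable_id _ _ _).
have low w : 0 <= w -> Lmap sigma2 (point_mass sbar) w <= Lmap sigma2 mu w.
  move=> w0; apply: le_trans (Lmap_ge _ _ _ _ _ hsupp hmean ha has hsb hsigma2 _ w0).
  rewrite (LmapE _ _ _ _ _ dsupp dmean ha has hsb hsigma2 _ w0) /Bmap.
  rewrite point_mass_expectation//= invf_div le_eqVlt; apply/orP; left; apply/eqP.
  by field; rewrite gt_eqF.
have upp w : 0 <= w -> Lmap sigma2 mu w <= Lmap sigma2 (two_point has hsb) w.
  move=> w0; rewrite (LmapE _ _ _ _ _ hsupp hmean ha has hsb hsigma2 _ w0).
  rewrite (LmapE _ _ _ _ _ tsupp tmean ha has hsb hsigma2 _ w0) lerD2r.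
  rewrite lef_pV2 ?posrE; last 2 first.
  - exact: (Bmap_gt0 _ _ _ _ _ hsupp hmean ha has hsb hsigma2 _ w0).
  - exact: (Bmap_gt0 _ _ _ _ _ tsupp tmean ha has hsb hsigma2 _ w0).
  (* Inversion has reversed the order: what remains is that [Bmap] of the two-point law is at most
     [Bmap] of [mu]. *)
  apply: le_trans (Bmap_chord _ _ _ _ _ hsupp hmean ha has hsb hsigma2 _ w0).
  rewrite /Bmap two_point_expectation//.
  - by rewrite divr_ge0// addr_ge0 ?(ltW hsigma2)// mulr_ge0.
  - by rewrite divr_ge0// addr_ge0 ?(ltW hsigma2)// mulr_ge0.
split=> [w w0|pi hpi]; first by rewrite low ?upp// ltW.
have ex nu smu mnu := ex_greatest_fixed_point _ _ _ _ hsigma2 ha has hsb nu pi smu mnu hpi.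
have [t1 [m1 _ _ _]] := ex _ dsupp dmean.
have [t2 [m2 _ _ _]] := ex _ hsupp hmean.
have [t3 [m3 _ _ _]] := ex _ tsupp tmean.
have [le12 me12] := tauBplus_le _ _ _ _ hsigma2 ha has hsb _ _ pi
  dsupp dmean hsupp hmean low hpi.
have [le23 me23] := tauBplus_le _ _ _ _ hsigma2 ha has hsb _ _ pi
  hsupp hmean tsupp tmean upp hpi.
by split; [exists t1|exists t2|exists t3|rewrite le12|rewrite me12].
Qed.
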